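(* Let $N,K,\omega\in\mathbb{N}$, $\tau\in\mathbb{N}_0$, and for $i,j\in\{1,\ldots,N\}$, $k\in\{1,\ldots,K\}$ let $c_i:\mathbb{N}_0\to(-1,1)$, $\tau_{ijk}:\mathbb{N}_0\to\mathbb{N}_0$, $b_{ijk},I_i:\mathbb{N}_0\to\mathbb{R}$ be $\omega$-periodic functions, and let $f_{ijk}:\mathbb{R}\to\mathbb{R}$ be functions for which there are constants $F_{ijk}$ with $|f_{ijk}(x)-f_{ijk}(y)|\le F_{ijk}|x-y|$ for all $x,y\in\mathbb{R}$. Let $c_i^+=\max\{|c_i(1)|,\ldots,|c_i(\omega)|\}$ and $b_{ijk}^+=\max\{|b_{ijk}(1)|,\ldots,|b_{ijk}(\omega)|\}$. If the $N\times N$ matrix $$\mathcal{M}=\mathcal{I}-\mathrm{diag}(c_1^+,\ldots,c_N^+)-\left[\sum_{k=1}^K b_{ijk}^+F_{ijk}\right]_{i,j=1}^N,$$ where $\mathcal{I}$ is the identity matrix, is a non-singular M-matrix, then the model $$x_i(m+1)=c_i(m)\,x_i(m-\tau)+\sum_{j=1}^N\sum_{k=1}^K b_{ijk}(m)f_{ijk}\big(x_j(m-\tau_{ijk}(m))\big)+I_i(m),\quad m\in\mathbb{N}_0,\ i\in\{1,\ldots,N\},$$ has a unique $\omega$-periodic solution, and this solution is globally exponentially stable.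
   Context: $\mathbb{N}=\{1,2,\ldots\}$, $\mathbb{N}_0=\mathbb{N}\cup\{0\}$. Put $r=-\max_{i,j,k,m}\{\tau_{ijk}(m),\tau\}$. For $I\subseteq\mathbb{R}$, $I_{\mathbb{Z}}=I\cap\mathbb{Z}$. $X$ is the space of functions $\alpha:[r,0]_{\mathbb{Z}}\to\mathbb{R}$ with norm $\|\alpha\|=\max_{j=r,\ldots,0}|\alpha(j)|$. $X^N$ carries the norm $\|\overline\alpha\|=\max_{i=1,\ldots,N}\|\alpha_i\|$. For $\overline{x}=(x_1,\ldots,x_N):[r,+\infty)_{\mathbb{Z}}\to\mathbb{R}^N$ and $m\in\mathbb{N}_0$, $\overline{x}_m\in X^N$ is defined by $\overline{x}_m(j)=\overline{x}(m+j)$, $j=r,\ldots,0$. For $\overline\alpha\in X^N$, $\overline{x}(\cdot,\overline\alpha)$ is the unique solution with $\overline{x}_0=\overline\alpha$, and $\overline{x}_m(\cdot,\overline\alpha)$ is its segment at time $m$. A function $g$ on $\mathbb{N}_0$ is $\omega$-periodic if $g(m+\omega)=g(m)$ for all $m\in\mathbb{N}_0$; an $\omega$-periodic solution is a solution $\overline{x}^*:[r,+\infty)_{\mathbb{Z}}\to\mathbb{R}^N$ with $\overline{x}^*(m+\omega)=\overline{x}^*(m)$ for all integers $m\ge r$. A solution $\overline{x}^*$ is globally exponentially stable if there are $C>0$ and $\zeta\in(0,1)$ such that $\|\overline{x}_m(\cdot,\overline\alpha)-\overline{x}^*_m\|\le C\zeta^m\|\overline\alpha-\overline{x}^*_0\|$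 for all $\overline\alpha\in X^N$ and $m\in\mathbb{N}_0$. A non-singular M-matrix is a real square matrix with non-positive off-diagonal entries all of whose eigenvalues have positive real part (equivalently, with all principal minors positive). *)

(* Defs.v *)
(* The real numbers are an arbitrary realType R. *)
From HB Require Import structures.
From mathcomp Require Import all_boot all_order all_algebra.
From mathcomp Require Import complex zify.
From mathcomp Require Import reals.

Set Implicit Arguments.
Unset Strict Implicit.
Unset Printing Implicit Defensive.

Import Order.TTheory GRing.Theory Num.Theory.
Local Open Scope ring_scope.

Definition periodic (T : Type) (omega : nat) (g : nat -> T) : Prop :=
  forall m, g (m + omega)%N = g m.

Definition lipschitz_with (R : realType) (L : R) (g : R -> R) : Prop :=
  forall x y, `|g x - g y| <= L * `|x - y|.

Definition nonsingular_Mmatrix (R : realType) (n : nat) (A : 'M[R]_n) : Prop :=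
  (forall i j, i != j -> A i j <= 0) /\
  (forall z : R[i], eigenvalue (map_mx (real_complex R) A) z ->
     0 < complex.Re z).

(* The values |g(m)| are nonnegative, so 0 is a harmless start value for the
   maximum. *)
Definition period_max (R : realType) (omega : nat) (g : nat -> R) : R :=
  \big[Num.max/0]_(1 <= m < omega.+1) `|g m|.

Definition model_matrix (R : realType) (N K omega : nat)
    (c : 'I_N -> nat -> R) (b : 'I_N -> 'I_N -> 'I_K -> nat -> R)
    (F : 'I_N -> 'I_N -> 'I_K -> R) : 'M[R]_N :=
  1%:M - diag_mx (\row_i period_max omega (c i))
       - \matrix_(i, j) \sum_(k < K) period_max omega (b i j k) * F i j k.

(* -r, i.e. the largest delay.  The delays d i j k being omega-periodic, their
   maximum over all times is attained on one period (see delay_le_max). *)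
Definition max_delay (N K omega tau : nat)
    (d : 'I_N -> 'I_N -> 'I_K -> nat -> nat) : nat :=
  maxn tau (\max_(i < N) \max_(j < N) \max_(k < K) \max_(m < omega) d i j k m).

(* X for r = - h.  The index l : 'I_h.+1 encodes the time - l, so that l runs
   through 0, ..., h as the time runs backwards from 0 to r. *)
Definition phase (R : realType) (h : nat) := {ffun 'I_h.+1 -> R}.

Definition phase_norm (R : realType) (h : nat) (alpha : phase R h) : R :=
  \big[Num.max/0]_(l < h.+1) `|alpha l|.

Definition phaseN (R : realType) (N h : nat) := {ffun 'I_N -> phase R h}.

Definition phaseN_norm (R : realType) (N h : nat) (alpha : phaseN R N h) : R :=
  \big[Num.max/0]_(i < N) phase_norm (alpha i).

(* Functions [r, +oo)_Z -> R^N are represented by functions on all of int; their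
   values at times before r = - h are junk, which nothing below depends on as
   long as h bounds all the delays. *)
Definition trajectory (R : realType) (N : nat) := int -> 'rV[R]_N.

Definition segment (R : realType) (N h : nat) (x : trajectory R N) (m : nat) :
    phaseN R N h :=
  [ffun i => [ffun l : 'I_h.+1 => x (m%:Z - l%:Z) 0 i]].

Definition is_solution (R : realType) (N K tau : nat)
    (c : 'I_N -> nat -> R) (d : 'I_N -> 'I_N -> 'I_K -> nat -> nat)
    (b : 'I_N -> 'I_N -> 'I_K -> nat -> R) (I : 'I_N -> nat -> R)
    (f : 'I_N -> 'I_N -> 'I_K -> R -> R) (x : trajectory R N) : Prop :=
  forall (m : nat) (i : 'I_N),
    x (m.+1)%:Z 0 i =
      c i m * x (m%:Z - tau%:Z) 0 i
      + \sum_(j < N) \sum_(k < K)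
          b i j k m * f i j k (x (m%:Z - (d i j k m)%:Z) 0 j)
      + I i m.

Definition periodic_trajectory (R : realType) (N h omega : nat)
    (x : trajectory R N) : Prop :=
  forall m : int, - h%:Z <= m -> x (m + omega%:Z) = x m.

(* Equality as functions on [- h, +oo)_Z. *)
Definition eq_trajectory (R : realType) (N h : nat) (x y : trajectory R N) :
    Prop :=
  forall m : int, - h%:Z <= m -> x m = y m.

(* sol is the set of all solutions; x ranges over the solutions with initial
   segment alpha, of which there is exactly one on [- h, +oo)_Z (see
   solution_exists and solution_unique). *)
Definition globally_exponentially_stable (R : realType) (N h : nat)
    (sol : trajectory R N -> Prop) (xs : trajectory R N) : Prop :=
  exists C zeta : R, [/\ 0 < C, 0 < zeta, zeta < 1 &
    forall (alpha : phaseN R N h) (x : trajectory R N),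
      sol x -> segment h x 0 = alpha ->
      forall m : nat,
        phaseN_norm (segment h x m - segment h xs m)
          <= C * zeta ^+ m * phaseN_norm (alpha - segment h xs 0)].

Lemma delay_le_max (N K omega tau : nat)
    (d : 'I_N -> 'I_N -> 'I_K -> nat -> nat) :
  (0 < omega)%N -> (forall i j k, periodic omega (d i j k)) ->
  forall i j k m, (d i j k m <= max_delay omega tau d)%N.
Proof.
move=> w0 dper i j k m.
have -> : d i j k m = d i j k (m %% omega)%N.
  rewrite {1}(divn_eq m omega) addnC; elim: (m %/ omega)%N => [|q IH].
    by rewrite mul0n addn0.
  by rewrite mulSn addnCA addnC dper.
rewrite leq_max; apply/orP; right.
apply: leq_trans (leq_bigmax i); apply: leq_trans (leq_bigmax j).
apply: leq_trans (leq_bigmax k).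
exact: (leq_bigmax (Ordinal (ltn_pmod m w0))).
Qed.

Section WellPosed.
Variables (R : realType) (N K h tau : nat).
Variables (c : 'I_N -> nat -> R) (d : 'I_N -> 'I_N -> 'I_K -> nat -> nat).
Variables (b : 'I_N -> 'I_N -> 'I_K -> nat -> R) (I : 'I_N -> nat -> R).
Variable f : 'I_N -> 'I_N -> 'I_K -> R -> R.
Hypothesis tau_le : (tau <= h)%N.
Hypothesis d_le : forall i j k m, (d i j k m <= h)%N.

Let next (m : nat) (a : phaseN R N h) (i : 'I_N) : R :=
  c i m * a i (inord tau)
  + \sum_(j < N) \sum_(k < K) b i j k m * f i j k (a j (inord (d i j k m)))
  + I i m.

Let step (m : nat) (a : phaseN R N h) : phaseN R N h :=
  [ffun i => [ffun l : 'I_h.+1 =>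
    if l == 0%N :> nat then next m a i else a i (inord l.-1)]].

Let state (alpha : phaseN R N h) : nat -> phaseN R N h :=
  fix state n := if n is n'.+1 then step n' (state n') else alpha.

Lemma solution_exists (alpha : phaseN R N h) :
  exists x, is_solution tau c d b I f x /\ segment h x 0 = alpha.
Proof.
pose x (t : int) : 'rV[R]_N := \row_i
  match t with Posz n => state alpha n i ord0
             | Negz n => alpha i (inord n.+1) end.
have xE n i (l : nat) : (l <= h)%N ->
    state alpha n i (inord l) = x (n%:Z - l%:Z) 0 i.
  elim: n l => [|n IH] [|l] lh; rewrite mxE.
  - by rewrite subr0 /=; congr (alpha i _); apply/val_inj; rewrite /= inordK.
  - by rewrite sub0r -NegzE.
  - by rewrite subr0; congr (state alpha _ i _); apply/val_inj; rewrite /= inordK.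
  - rewrite [LHS]/= !ffunE inordK //= IH; last exact: ltnW.
    have -> : n.+1%:Z - l.+1%:Z = n%:Z - l%:Z by lia.
    by rewrite mxE.
exists x; split=> [m i|].
  rewrite mxE [LHS]/= !ffunE /= /next xE //; congr (_ + _ + _).
  by apply: eq_bigr => j _; apply: eq_bigr => k _; rewrite xE.
apply/ffunP => i; apply/ffunP => l; rewrite !ffunE -xE ?inord_val //.
by rewrite -ltnS.
Qed.

Lemma solution_unique (x y : trajectory R N) :
  is_solution tau c d b I f x -> is_solution tau c d b I f y ->
  segment h x 0 = segment h y 0 -> eq_trajectory h x y.
Proof.
move=> solx soly xy0.
have base (t : int) : - h%:Z <= t -> t <= 0 -> x t = y t.
  move=> ht t0; apply/rowP => i.
  have tE : t = 0%:Z - `|t|%N%:Z by lia.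
  have lh : (`|t|%N < h.+1)%N by lia.
  move/ffunP/(_ i)/ffunP/(_ (Ordinal lh)): xy0.
  by rewrite !ffunE /= -tE.
have all_le (n : nat) (t : int) : - h%:Z <= t -> t <= n%:Z -> x t = y t.
  elim: n t => [|n IH] t ht tn; first exact: base.
  have [tn'|tn'] := lerP t n%:Z; first exact: IH.
  have -> : t = n.+1%:Z by lia.
  apply/rowP => i; rewrite solx soly IH; [|lia|lia].
  congr (_ + _ + _); apply: eq_bigr => j _; apply: eq_bigr => k _.
  by rewrite IH //; have := d_le i j k n; lia.
move=> t ht; apply: (all_le `|t|%N) => //; lia.
Qed.

End WellPosed.

(* Main.v *)
Require Import Defs.
From HB Require Import structures.
From mathcomp Require Import all_boot all_order all_algebra.
From mathcomp Require Import complex.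
From mathcomp Require Import reals.
From mathcomp Require Import polyrcf zify ring lra.
From mathcomp Require Import boolp classical_sets functions.
From mathcomp Require Import topology normedtype sequences.

(** Two solutions of the model contract towards each other at a geometric rate,
    and everything else follows from that.

    The rate comes from the M-matrix hypothesis. A non-singular M-matrix [M] has
    a positive vector [v] with [M v = (1, ..., 1)]
    ([Mmatrix_positive_preimage]). Writing [M = 1 - P], where [P] is the
    nonnegative matrix of the gains of the model, this says [P v = v - 1], so
    that [P v <= zeta^(h+1) v] for some [zeta < 1], where [h] is the largest
    delay ([model_decay_rate]). Subtracting the equations of two solutions [x]
    and [y] and using the Lipschitz bounds, [|x_i - y_i| / v_i] at time [m + 1]
    is at most [zeta^(h+1)] times its maximum over the times [m - h, ..., m]
    and all coordinates ([solutions_step]); by induction it decays like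
    [zeta^m] ([solutions_approach]). This already gives the exponential
    stability of every solution, and the uniqueness of a periodic one, since the
    distance of two periodic solutions cannot decay unless it vanishes.

    For existence, let [x] be any solution. The coefficients being periodic, the
    translates of [x] by multiples of [omega] are again solutions
    ([solution_shift]). Comparing [x] with its translate by [omega] shows that
    [n |-> x (t + n omega)] has geometrically small increments, so it converges;
    the limit is [omega]-periodic in [t], and it is a solution because the right
    hand side of the model is continuous ([solution_limit]).

    The positive vector is found by deforming [M] to [t + M] with [t >= 0]. The
    spectral hypothesis keeps [det (t + M)] positive, and
    [q(t) = adj (t + M) (1, ..., 1)] is a vector of polynomials in [t] which is
    positive for large [t]. Going down from there to [t = 0], at the first zero
    of a coordinate [q_i] all the coordinates would still be nonnegative, but
    then row [i] of [(t + M) q(t) = det (t + M) (1, ..., 1)] has a nonpositive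
    left hand side. So [q(0)] is positive, and [v = q(0) / det M]. *)

Set Implicit Arguments.
Unset Strict Implicit.
Unset Printing Implicit Defensive.

Import Order.TTheory GRing.Theory Num.Theory.
Import numFieldNormedType.Exports.
Local Open Scope ring_scope.

(** * Positive vectors of M-matrices *)

Lemma poly_gt0_right (R : rcfType) (p : {poly R}) (a : R) :
  0 < lead_coef p -> (forall t, a <= t -> ~~ root p t) -> 0 < p.[a].
Proof.
move=> lc_gt0 noroot; rewrite ltNge; apply/negP => pa_le0.
have [M pM] := poly_pinfty_gt_lc lc_gt0.
have leM : a <= Num.max a M by rewrite le_max lexx.
have [|t /andP[le_at _] rt] := poly_ivt leM (p := p).
  by rewrite pa_le0 (le_trans (ltW lc_gt0)) // pM // le_max lexx orbT.
by have := noroot t le_at; rewrite rt.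
Qed.

(** A continuity argument in polynomial form: positivity of a finite family,
    which holds from [T] on, persists down to [a] as long as it cannot be lost
    at a point where all members are still nonnegative. The point where it
    would be lost first, coming from the right, is the largest root of the
    product of the family. *)
Lemma polys_gt0_right (R : rcfType) (n : nat) (p : 'I_n -> {poly R}) (a T : R) :
  (forall i t, T <= t -> 0 < (p i).[t]) ->
  (forall t, a <= t -> (forall i, 0 <= (p i).[t]) -> forall i, 0 < (p i).[t]) ->
  forall i, 0 < (p i).[a].
Proof.
move=> p_large p_step.
pose P := \prod_i p i.
have P_rootP t : reflect (exists i, root (p i) t) (root P t).
  rewrite rootE horner_prod; apply: (iffP (prodf_eq0 _ _)).
    by case=> i _ ri; exists i.
  by case=> i ri; exists i.
have P_neq0 : P != 0.
  apply/eqP => P0; have [i +] : exists i, root (p i) T.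
    by apply/P_rootP; rewrite P0 root0.
  by rewrite rootE => /eqP pi0; have := p_large i T (lexx _); rewrite pi0 ltxx.
(* Without roots to the right of [t], no member changes sign between [t] and
   large arguments, where it is positive. *)
have ge0_of t : (forall s, t < s -> ~~ root P s) -> forall i, 0 <= (p i).[t].
  move=> noroot i; rewrite leNgt; apply/negP => pit.
  have le_t : t <= Num.max t T by rewrite le_max lexx.
  have [|s /andP[le_ts _] rs] := poly_ivt le_t (p := p i).
    by rewrite (ltW pit) ltW // p_large // le_max lexx orbT.
  have : t < s.
    rewrite lt_neqAle le_ts andbT; apply: contraTneq rs => <-.
    by rewrite rootE lt_eqF.
  by move/noroot/negP; apply; apply/P_rootP; exists i.
have [/hasP[s0 s0r as0]|/hasPn noroot] := boolP (has (fun s => a <= s) (rootsR P)).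
  pose t := \big[Num.max/s0]_(s <- rootsR P) s.
  have le_t s : s \in rootsR P -> s <= t by move=> sr; exact: le_bigmax_seq.
  have rt : root P t.
    suff : t \in rootsR P.
      by rewrite -(roots_on_rootsR P_neq0) => /andP[].
    rewrite /t big_seq; elim/big_ind: _ => //= x y xr yr.
    by rewrite /Num.max; case: ifP.
  have noroot s : t < s -> ~~ root P s.
    move=> lt_ts; apply/negP => rs; have := lt_ts; rewrite ltNge le_t //.
    by rewrite -(roots_on_rootsR P_neq0) in_itv.
  have [i ri] := elimT (P_rootP _) rt.
  have := p_step t (le_trans as0 (le_t _ s0r)) (ge0_of t noroot) i.
  by rewrite (eqP ri) ltxx.
apply: p_step => //; apply: ge0_of => s lt_as; apply/negP => rs.
have := noroot s; rewrite (ltW lt_as) => /(_ _)/negP; apply => //.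
by rewrite -(roots_on_rootsR P_neq0) in_itv.
Qed.

(** [char_poly (- A)] evaluated at [t] is [det (t + A)]. It is monic and a root
    [t >= 0] would make [- t] an eigenvalue of [A] that is not in the right half
    plane. *)
Lemma char_poly_opp_gt0 (R : realType) (n : nat) (A : 'M[R]_n) :
  (forall z : R[i], eigenvalue (map_mx (real_complex R) A) z ->
     0 < complex.Re z) ->
  forall t, 0 <= t -> 0 < (char_poly (- A)).[t].
Proof.
move=> A_eigen t t_ge0; apply: poly_gt0_right => [|s le_ts].
  by rewrite (monicP (char_poly_monic _)) ltr01.
rewrite -eigenvalue_root_char; apply/negP => /eigenvalueP[v vA v_neq0].
have : 0 < complex.Re (- real_complex R s).
  apply: A_eigen; apply/eigenvalueP; exists (map_mx (real_complex R) v).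
    rewrite -map_mxM -rmorphN -map_mxZ; congr (map_mx _ _).
    by apply: oppr_inj; rewrite -mulmxN vA scaleNr opprK.
  by rewrite map_mx_eq0.
by rewrite /= oppr_gt0 ltNge (le_trans t_ge0 le_ts).
Qed.

(** This is the only consequence of the M-matrix property that the model needs;
    [v] is a weight for which [A] is strictly diagonally dominant. *)
Lemma Mmatrix_positive_preimage (R : realType) (n : nat) (A : 'M[R]_n) :
  nonsingular_Mmatrix A ->
  exists v : 'I_n -> R,
    (forall i, 0 < v i) /\ (forall i, \sum_j A i j * v j = 1).
Proof.
move=> [A_off /char_poly_opp_gt0 d_gt0]; set d := char_poly _ in d_gt0.
pose B := char_poly_mx (- A).
(* [q] is [adj (t + A)] applied to the vector of ones, as polynomials in [t]. *)
pose q j : {poly R} := \sum_k \adj B j k.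
have q_eq i t :
    t * (q i).[t] + \sum_j A i j * (q j).[t] = d.[t].
  have : \sum_j B i j * q j = d.
    rewrite /q; under eq_bigr do rewrite big_distrr.
    rewrite exchange_big (bigD1 i) //= [X in _ + X]big1 => [|k k_neq].
      have := congr1 (fun M : 'M_n => M i i) (mul_mx_adj B).
      by rewrite /= !mxE eqxx mulr1n addr0 => ->.
    have := congr1 (fun M : 'M_n => M i k) (mul_mx_adj B).
    by rewrite /= !mxE eq_sym (negPf k_neq).
  move/(congr1 (horner_eval t)); rewrite /horner_eval horner_sum => <-.
  under [RHS]eq_bigr do rewrite hornerM !mxE polyCN opprK hornerD hornerC mulrDl.
  rewrite big_split /=; congr (_ + _).
  rewrite (bigD1 i) //= eqxx mulr1n hornerX big1 ?addr0 // => j j_neq.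
  by rewrite eq_sym (negPf j_neq) mulr0n horner0 mul0r.
(* If [q i] vanished at [t], then row [i] of [q_eq] would express [d.[t] > 0]
   as a sum of the off-diagonal terms, which are nonpositive. *)
have q_step t : 0 <= t -> (forall i, 0 <= (q i).[t]) -> forall i, 0 < (q i).[t].
  move=> t_ge0 q_ge0 i; rewrite lt_neqAle q_ge0 andbT.
  apply/negP => /eqP qi0; have := d_gt0 t t_ge0.
  rewrite -(q_eq i) -qi0 mulr0 add0r ltNge sumr_le0 // => j _.
  have [->|j_neq] := eqVneq j i; first by rewrite -qi0 mulr0.
  by rewrite mulr_le0_ge0 // A_off // eq_sym.
(* For [t] beyond this [T] all row sums of [t + A] are positive. *)
pose T := \sum_i \sum_j `|A i j| + 1.
have q_large i t : T <= t -> 0 < (q i).[t].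
  move=> Tt.
  have t_ge0 : 0 <= t.
    apply: le_trans Tt; apply: addr_ge0 => //.
    by apply: sumr_ge0 => k _; apply: sumr_ge0.
  (* In the row of the smallest coordinate, replacing every coordinate by that
     one can only increase the left hand side of [q_eq]. *)
  pose k := [arg min_(k < i) (q k).[t]]%O.
  have k_min j : (q k).[t] <= (q j).[t].
    by rewrite /k; case: arg_minP => // l _; apply.
  apply: lt_le_trans (k_min i); have := d_gt0 t t_ge0; rewrite -(q_eq k) => gt0.
  have : 0 < (t + \sum_j A k j) * (q k).[t].
    apply: lt_le_trans gt0 _; rewrite mulrDl lerD2l mulr_suml ler_sum // => j _.
    have [->|j_neq] := eqVneq j k; first by [].
    by apply: ler_wnM2l (k_min j); rewrite A_off // eq_sym.
  rewrite pmulr_rgt0 //.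
  suff : - \sum_j A k j <= \sum_i \sum_j `|A i j| by rewrite /T in Tt; lra.
  rewrite -sumrN; apply: le_trans (ler_sum _ (fun j _ => ler_norm _)) _.
  under eq_bigr do rewrite normrN.
  rewrite [leRHS](bigD1 k) //= lerDl.
  by apply: sumr_ge0 => l _; apply: sumr_ge0.
have q_gt0 := polys_gt0_right q_large q_step.
have d0 := d_gt0 0 (lexx 0).
exists (fun i => (q i).[0] / d.[0]); split=> i; first by rewrite divr_gt0.
under eq_bigr do rewrite mulrA.
have := q_eq i 0; rewrite mul0r add0r -mulr_suml => ->.
by rewrite divff ?gt_eqF.
Qed.

(** * The decay rate of the model *)

Lemma periodicMn (T : Type) (omega : nat) (g : nat -> T) :
  periodic omega g -> forall m n, g (m + n * omega)%N = g m.
Proof.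
move=> g_per m; elim=> [|n IH]; first by rewrite addn0.
by rewrite mulSn addnCA addnC g_per.
Qed.

Lemma norm_le_period_max (R : realType) (omega : nat) (g : nat -> R) :
  (0 < omega)%N -> periodic omega g ->
  forall m, `|g m| <= period_max omega g.
Proof.
move=> w0 g_per m.
have [k kw ->] : exists2 k, (1 <= k < omega.+1)%N & g m = g k.
  rewrite (divn_eq m omega) addnC periodicMn //.
  (* The maximum is over 1, ..., omega, so omega stands for the residue 0. *)
  have [->|r_gt0] := posnP (m %% omega)%N.
    by exists omega; [lia|rewrite -(g_per 0%N)].
  by exists (m %% omega)%N; rewrite // r_gt0 ltnW // ltnS ltn_pmod.
by apply: (le_bigmax_seq 0 k predT (fun k => `|g k|)); rewrite ?mem_index_iota.
Qed.

Lemma period_max_ge0 (R : realType) (omega : nat) (g : nat -> R) :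
  0 <= period_max omega g.
Proof. exact: bigmax_ge_id. Qed.

Lemma lipschitz_with_ge0 (R : realType) (L : R) (g : R -> R) :
  lipschitz_with L g -> 0 <= L.
Proof.
move=> /(_ 1 0); rewrite subr0 normr1 mulr1; exact: le_trans.
Qed.

(** The exponent [h.+1] is what makes [zeta] a decay rate per time step: over a
    window of [h.+1] consecutive times a weighted difference of solutions
    shrinks by the factor [zeta ^+ h.+1] only once. *)
Lemma model_decay_rate (R : realType) (N K omega h : nat)
    (c : 'I_N -> nat -> R) (b : 'I_N -> 'I_N -> 'I_K -> nat -> R)
    (F : 'I_N -> 'I_N -> 'I_K -> R) :
  (forall i j k, 0 <= F i j k) ->
  nonsingular_Mmatrix (model_matrix omega c b F) ->
  exists (v : 'I_N -> R) (zeta : R),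
    [/\ 0 < zeta, zeta < 1, forall i, 1 <= v i & forall i,
      period_max omega (c i) * v i
      + \sum_j \sum_k period_max omega (b i j k) * F i j k * v j
        <= zeta ^+ h.+1 * v i].
Proof.
move=> F_ge0 /Mmatrix_positive_preimage[v [v_gt0 Mv]].
pose row_sum i := period_max omega (c i) * v i
      + \sum_j \sum_k period_max omega (b i j k) * F i j k * v j.
have row_sumE i : row_sum i = v i - 1.
  rewrite -(Mv i) /row_sum.
  under [in RHS]eq_bigr do rewrite !mxE 2!mulrDl !mulNr mulr_suml.
  rewrite !big_split /= !sumrN.
  have diag a : \sum_j a *+ (i == j) * v j = a * v i.
    rewrite (bigD1 i) //= eqxx mulr1n big1 ?addr0 // => j j_neq.
    by rewrite eq_sym (negPf j_neq) mulr0n mul0r.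
  by rewrite !diag mul1r; lra.
have v_ge1 i : 1 <= v i.
  rewrite -subr_ge0 -row_sumE addr_ge0 //.
    by rewrite mulr_ge0 ?period_max_ge0 ?ltW.
  apply: sumr_ge0 => j _; apply: sumr_ge0 => k _.
  by rewrite mulr_ge0 ?(ltW (v_gt0 j)) // mulr_ge0 ?period_max_ge0.
pose V := 2 + \sum_i v i.
have V_gt1 : 1 < V.
  apply: (lt_le_trans (ltr1n R 2)); rewrite lerDl sumr_ge0 // => j _.
  exact: ltW.
have V_ge i : v i <= V.
  rewrite /V (bigD1 i) //= addrCA lerDl addr_ge0 //.
  by apply: sumr_ge0 => j _; exact: ltW.
have h_gt0 : 0 < h.+1%:R :> R by rewrite ltr0n.
(* [V] bounds all [v i] and exceeds 1, so [v i - 1 <= (1 - V^-1) * v i]; the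
   rate is [zeta = 1 - e], and [(1 - e) ^+ h.+1 >= 1 - V^-1] is the Bernoulli
   inequality. *)
pose e : R := (V * h.+1%:R)^-1.
have e_gt0 : 0 < e by rewrite invr_gt0 mulr_gt0 //; lra.
have e_lt1 : e < 1.
  rewrite invf_lt1; last by rewrite mulr_gt0 //; lra.
  by rewrite (lt_le_trans V_gt1) // ler_peMr ?ler1n //; lra.
exists v, (1 - e); split=> // [||i]; [lra|lra|].
have bern : 1 - V^-1 <= (1 - e) ^+ h.+1.
  have -> : V^-1 = h.+1%:R * e.
    by rewrite /e invfM mulrCA divff ?gt_eqF // mulr1.
  elim: h.+1 => [|n IH]; first by rewrite mul0r subr0 expr0.
  rewrite exprS; apply: (@le_trans _ _ ((1 - e) * (1 - n%:R * e))).
    have : 0 <= n%:R * e * e by rewrite !mulr_ge0 ?ler0n // ltW.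
    by rewrite -natr1; nra.
  by rewrite ler_wpM2l // subr_ge0 ltW.
rewrite -/(row_sum i) row_sumE; apply: le_trans (ler_wpM2r (ltW (v_gt0 i)) bern).
rewrite mulrBl mul1r lerD2l lerN2 mulrC ler_pdivrMr; last lra.
by rewrite mul1r.
Qed.

(** * Sequences with geometric bounds, Lipschitz continuity *)

Lemma le_geometric_le0 (R : realType) (a C z : R) :
  0 <= z -> z < 1 -> (forall n, a <= C * z ^+ n) -> a <= 0.
Proof.
move=> z_ge0 z_lt1 a_le.
have Cz : (geometric C z n @[n --> \oo] --> 0)%classic
  by apply: cvg_geometric; rewrite ger0_norm.
rewrite -(cvg_lim _ Cz); last exact: Rhausdorff.
apply: limr_ge; first by apply/cvg_ex; exists 0.
by apply: nearW => n; exact: a_le.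
Qed.

Lemma geometric_increments_cvg (R : realType) (u : R ^nat) (C z : R) :
  0 <= z -> z < 1 -> (forall n, `|u n.+1 - u n| <= C * z ^+ n) -> cvgn u.
Proof.
move=> z_ge0 z_lt1 u_le.
have : cvgn (series (telescope u)).
  apply: normed_cvg; apply: (@series_le_cvg _ _ (geometric C z)) => //.
  - by move=> n; exact: normr_ge0.
  - by move=> n; exact: le_trans (normr_ge0 _) (u_le n).
  - by apply: is_cvg_geometric_series; rewrite ger0_norm.
rewrite telescopeK => cvg_shift.
have -> : u = [sequence u n - u 0%N]_n \+ cst (u 0%N).
  by apply/funext => n /=; rewrite subrK.
by apply: is_cvgD => //; exact: is_cvg_cst.
Qed.

Lemma lipschitz_with_continuous (R : realType) (L : R) (g : R -> R) :
  lipschitz_with L g -> continuous g.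
Proof.
move=> gL x; apply/cvgrPdist_le => e e_gt0.
have L_ge0 := lipschitz_with_ge0 gL.
have L1 : 0 < L + 1 by rewrite ltr_wpDl.
near=> y; apply: le_trans (gL x y) _.
apply: (@le_trans _ _ ((L + 1) * `|x - y|)).
  by rewrite ler_wpM2r // lerDl.
rewrite mulrC -ler_pdivlMr //.
near: y; apply: cvgr_dist_le => //; by rewrite divr_gt0.
Unshelve. all: by end_near.
Qed.

(** * Norms of segments *)

Lemma norm_le_phaseN_norm (R : realType) (N h : nat) (a : phaseN R N h) i l :
  `|a i l| <= phaseN_norm a.
Proof.
by apply: (@le_trans _ _ (phase_norm (a i)));
  [exact: (le_bigmax _ (fun l => `|a i l|)) |
   exact: (le_bigmax _ (fun i => phase_norm (a i)))].
Qed.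

Lemma phaseN_norm_le (R : realType) (N h : nat) (a : phaseN R N h) (B : R) :
  0 <= B -> (forall i l, `|a i l| <= B) -> phaseN_norm a <= B.
Proof. by move=> B_ge0 aB; apply: bigmax_le => // i _; apply: bigmax_le. Qed.

Lemma phaseN_norm_ge0 (R : realType) (N h : nat) (a : phaseN R N h) :
  0 <= phaseN_norm a.
Proof. exact: bigmax_ge_id. Qed.

(** * Dynamics of the model *)

Section Model.
Variables (R : realType) (N K omega tau h : nat).
Variables (c : 'I_N -> nat -> R) (d : 'I_N -> 'I_N -> 'I_K -> nat -> nat).
Variables (b : 'I_N -> 'I_N -> 'I_K -> nat -> R) (I : 'I_N -> nat -> R).
Variables (f : 'I_N -> 'I_N -> 'I_K -> R -> R) (F : 'I_N -> 'I_N -> 'I_K -> R).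
Hypothesis tau_le : (tau <= h)%N.
Hypothesis d_le : forall i j k m, (d i j k m <= h)%N.
Hypothesis omega_gt0 : (0 < omega)%N.
Hypothesis c_periodic : forall i, periodic omega (c i).
Hypothesis d_periodic : forall i j k, periodic omega (d i j k).
Hypothesis b_periodic : forall i j k, periodic omega (b i j k).
Hypothesis I_periodic : forall i, periodic omega (I i).
Hypothesis f_lipschitz : forall i j k, lipschitz_with (F i j k) (f i j k).

Let sol := is_solution tau c d b I f.

Lemma solution_shift (x : trajectory R N) (n : nat) :
  sol x -> sol (fun t => x (t + (n * omega)%N%:Z)).
Proof.
move=> solx m i.
have -> : m.+1%:Z + (n * omega)%N%:Z = (m + n * omega).+1%:Z by lia.
rewrite solx (periodicMn (c_periodic i)) (periodicMn (I_periodic i)).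
congr (_ * x _ 0 i + _ + _); first lia.
apply: eq_bigr => j _; apply: eq_bigr => k _.
rewrite (periodicMn (b_periodic i j k)) (periodicMn (d_periodic i j k)).
by congr (_ * f i j k (x _ 0 j)); lia.
Qed.

(** The right hand side of the model at a given time involves finitely many
    values of the trajectory, each through a continuous function, so pointwise
    convergence at the times from [- h] on is enough. *)
Lemma solution_limit (u : nat -> trajectory R N) (x : trajectory R N) :
  (forall n, sol (u n)) ->
  (forall (t : int) i, - h%:Z <= t ->
     (u n t 0 i @[n --> \oo] --> x t 0 i)%classic) ->
  sol x.
Proof.
move=> solu u_cvg m i.
have delay_ge e : (e <= h)%N -> - h%:Z <= m%:Z - e%:Z by lia.
have u_next : (u n m.+1%:Z 0 i @[n --> \oo] --> x m.+1%:Z 0 i)%classic.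
  by apply: u_cvg; lia.
rewrite -(cvg_lim (@Rhausdorff R) u_next); apply: cvg_lim => //.
under eq_fun do rewrite solu.
apply: cvgD; last exact: cvg_cst.
apply: cvgD; first by apply: cvgMr; apply: u_cvg; exact: delay_ge.
apply: cvg_big => [|j _]; first exact: add_continuous.
apply: cvg_big => [|k _]; first exact: add_continuous.
apply: cvgMr.
apply: (continuous_cvg _ (@lipschitz_with_continuous _ _ _ (f_lipschitz i j k) _)).
exact/u_cvg/delay_ge.
Qed.

Variables (v : 'I_N -> R) (zeta : R).
Hypothesis zeta_gt0 : 0 < zeta.
Hypothesis zeta_lt1 : zeta < 1.
Hypothesis v_ge1 : forall i, 1 <= v i.
Hypothesis row_le : forall i,
  period_max omega (c i) * v i
  + \sum_j \sum_k period_max omega (b i j k) * F i j k * v j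
    <= zeta ^+ h.+1 * v i.

(** [E] bounds the weighted difference over the window of times that the model
    looks back to; the weights [v] turn the sum over coordinates into the
    contraction of [row_le]. *)
Lemma solutions_step (x y : trajectory R N) (m : nat) (E : R) :
  sol x -> sol y -> 0 <= E ->
  (forall j l, (l <= h)%N ->
     `|x (m%:Z - l%:Z) 0 j - y (m%:Z - l%:Z) 0 j| <= E * v j) ->
  forall i, `|x m.+1%:Z 0 i - y m.+1%:Z 0 i| <= E * (zeta ^+ h.+1 * v i).
Proof.
move=> solx soly E_ge0 xyE i; rewrite solx soly.
set cx := c i m * x _ _ _; set cy := c i m * y _ _ _.
set sx := \sum_j _; set sy := \sum_j _.
have -> : cx + sx + I i m - (cy + sy + I i m) = (cx - cy) + (sx - sy) by ring.
apply: le_trans (ler_wpM2l E_ge0 (row_le i)).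
rewrite mulrDr; apply: le_trans (ler_normD _ _) _; apply: lerD.
  rewrite -mulrBr normrM mulrCA.
  by rewrite ler_pM ?norm_le_period_max // xyE.
rewrite -sumrB mulr_sumr; apply: le_trans (ler_norm_sum _ _ _) _.
apply: ler_sum => j _.
rewrite -sumrB mulr_sumr; apply: le_trans (ler_norm_sum _ _ _) _.
apply: ler_sum => k _.
rewrite -mulrBr normrM -mulrA mulrCA.
apply: ler_pM; rewrite ?norm_le_period_max //.
apply: le_trans (f_lipschitz i j k _ _) _; rewrite mulrCA.
by apply: ler_wpM2l; [exact: lipschitz_with_ge0 (f_lipschitz i j k) | exact: xyE].
Qed.

(** Time is counted from [- h] so that one bound with natural exponents covers
    the initial window as well; there [zeta ^+ k >= zeta ^+ h] and [v i >= 1],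
    which is what the division by [zeta ^+ h] pays for. Afterwards, the oldest
    term of the window at time [m] has exponent [m], and [solutions_step]
    supplies the missing [h.+1] factors. *)
Lemma solutions_approach (x y : trajectory R N) :
  sol x -> sol y -> forall k i,
  `|x (k%:Z - h%:Z) 0 i - y (k%:Z - h%:Z) 0 i|
    <= phaseN_norm (segment h x 0 - segment h y 0) / zeta ^+ h * v i * zeta ^+ k.
Proof.
move=> solx soly; set D := phaseN_norm _ / _.
have D_ge0 : 0 <= D by rewrite divr_ge0 ?phaseN_norm_ge0 // exprn_ge0 // ltW.
elim/ltn_ind => k IH i; have [k_le|lt_hk] := leqP k h.
  have lh : (h - k < h.+1)%N by lia.
  have := norm_le_phaseN_norm (segment h x 0 - segment h y 0) i (Ordinal lh).
  rewrite !ffunE /=.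
  have -> : 0%:Z - (h - k)%N%:Z = k%:Z - h%:Z by lia.
  move/le_trans; apply.
  have -> : phaseN_norm (segment h x 0 - segment h y 0) = D * zeta ^+ h.
    by rewrite /D mulfVK // expf_eq0 gt_eqF // andbF.
  rewrite -mulrA ler_wpM2l // -[leLHS]mul1r.
  by rewrite ler_pM ?exprn_ge0 ?(ltW zeta_gt0) // ler_wiXn2l // ltW.
have [m kE] : exists m, k = (m + h).+1 by exists (k - h.+1)%N; lia.
have -> : k%:Z - h%:Z = m.+1%:Z by lia.
have -> : D * v i * zeta ^+ k = D * zeta ^+ m * (zeta ^+ h.+1 * v i).
  by rewrite kE -addnS exprD; ring.
apply: solutions_step => // [|j l l_le].
  by rewrite mulr_ge0 // exprn_ge0 // ltW.
have -> : m%:Z - l%:Z = (m + h - l)%N%:Z - h%:Z by lia.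
apply: le_trans (IH _ _ j) _; first lia.
rewrite mulrAC ler_wpM2r ?(le_trans ler01) // ler_wpM2l //.
by apply: ler_wiXn2l; rewrite ?ltW //; lia.
Qed.

(** The limit of the translates of an arbitrary solution by multiples of the
    period. Consecutive translates approach each other geometrically because
    they are the solutions [u 0] and [u 1], both looked at [n] periods later. *)
Lemma periodic_solution_exists :
  exists xs, sol xs /\ periodic_trajectory h omega xs.
Proof.
have [x [solx _]] := solution_exists c b I f tau_le d_le [ffun=> [ffun=> 0]].
pose u n : trajectory R N := fun t => x (t + (n * omega)%N%:Z).
have solu n : sol (u n) by exact: solution_shift.
pose D := phaseN_norm (segment h (u 1%N) 0 - segment h (u 0%N) 0) / zeta ^+ h.
have D_ge0 : 0 <= D by rewrite divr_ge0 ?phaseN_norm_ge0 // exprn_ge0 // ltW.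
have u_cvg (t : int) i : - h%:Z <= t -> cvgn (fun n => u n t 0 i).
  move=> t_ge; apply: (@geometric_increments_cvg _ _ (D * v i) zeta) => // [|n].
    exact: ltW.
  have [k tE] : exists k : nat, t = k%:Z - h%:Z by exists (absz (t + h%:Z)); lia.
  have := solutions_approach (solu 1%N) (solu 0%N) (k + n * omega) i.
  rewrite -/D /u.
  have -> : (k + n * omega)%N%:Z - h%:Z + (1 * omega)%N%:Z
     = t + (n.+1 * omega)%N%:Z by lia.
  have -> : (k + n * omega)%N%:Z - h%:Z + (0 * omega)%N%:Z
     = t + (n * omega)%N%:Z by lia.
  move/le_trans; apply; rewrite ler_wpM2l //.
    by rewrite mulr_ge0 // (le_trans ler01).
  apply: ler_wiXn2l; rewrite ?ltW //.
  by apply: leq_trans (leq_addl _ _); rewrite leq_pmulr.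
exists (fun t => \row_i limn (fun n => u n t 0 i)); split.
  by apply: solution_limit solu _ => t i t_ge; rewrite mxE; exact: u_cvg.
move=> t t_ge; apply/rowP => i; rewrite !mxE.
apply: cvg_lim; first exact: Rhausdorff.
have -> : (fun n => u n (t + omega%:Z) 0 i) = [sequence u n.+1 t 0 i]_n.
  apply/funext => n; rewrite /u /=.
  by congr (x _ 0 i); lia.
rewrite (cvg_shiftS (fun n => u n t 0 i)); exact: u_cvg.
Qed.

Lemma solution_stable (xs : trajectory R N) :
  sol xs -> globally_exponentially_stable h sol xs.
Proof.
move=> solxs.
have S_ge i : v i <= 1 + \sum_j v j.
  rewrite (bigD1 i) //= addrCA lerDl addr_ge0 //.
  by apply: sumr_ge0 => j _; rewrite (le_trans ler01).
have S_gt0 : 0 < 1 + \sum_j v j.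
  by rewrite ltr_pwDl // sumr_ge0 // => j _; rewrite (le_trans ler01).
exists ((1 + \sum_j v j) / zeta ^+ h), zeta; split=> //.
  by rewrite divr_gt0 // exprn_gt0.
move=> _ x solx <- m; set P := phaseN_norm (_ - segment h xs 0).
have P_ge0 : 0 <= P by exact: phaseN_norm_ge0.
have Z_ge0 k : 0 <= zeta ^+ k by rewrite exprn_ge0 // ltW.
apply: phaseN_norm_le => [|i l]; first by rewrite !mulr_ge0 ?invr_ge0 // ltW.
have l_le : (l <= h)%N by rewrite -ltnS.
rewrite !ffunE.
have -> : m%:Z - l%:Z = (m + h - l)%N%:Z - h%:Z by lia.
apply: le_trans (solutions_approach solx solxs _ _) _; rewrite -/P.
have -> : (1 + \sum_j v j) / zeta ^+ h * zeta ^+ m * P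
  = P / zeta ^+ h * (1 + \sum_j v j) * zeta ^+ m by ring.
apply: ler_pM => //.
- by rewrite !mulr_ge0 ?invr_ge0 // (le_trans ler01).
- by rewrite ler_wpM2l // mulr_ge0 ?invr_ge0.
- by apply: ler_wiXn2l; rewrite ?ltW //; lia.
Qed.

Lemma periodic_solution_unique (x y : trajectory R N) :
  sol x -> periodic_trajectory h omega x ->
  sol y -> periodic_trajectory h omega y -> eq_trajectory h x y.
Proof.
move=> solx x_per soly y_per t t_ge; apply/rowP => i.
have per_n z : periodic_trajectory h omega z ->
    forall n, z (t + (n * omega)%N%:Z) = z t :> 'rV[R]_N.
  move=> z_per; elim=> [|n IH]; first by rewrite mul0n addr0.
  rewrite -IH -(z_per (t + (n * omega)%N%:Z)); last lia.
  by congr (z _); lia.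
have [k tE] : exists k : nat, t = k%:Z - h%:Z by exists (absz (t + h%:Z)); lia.
apply/eqP; rewrite -subr_eq0 -normr_le0.
apply: (@le_geometric_le0 _ _
  (phaseN_norm (segment h x 0 - segment h y 0) / zeta ^+ h * v i) zeta) => // [|n].
  exact: ltW.
rewrite -(per_n x x_per n) -(per_n y y_per n) tE.
have -> : k%:Z - h%:Z + (n * omega)%N%:Z = (k + n * omega)%N%:Z - h%:Z by lia.
apply: le_trans (solutions_approach solx soly _ _) _.
rewrite ler_wpM2l //.
  rewrite !mulr_ge0 ?invr_ge0 ?phaseN_norm_ge0 ?exprn_ge0 ?(ltW zeta_gt0) //.
  by rewrite (le_trans ler01).
apply: ler_wiXn2l; rewrite ?ltW //.
by apply: leq_trans (leq_addl _ _); rewrite leq_pmulr.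
Qed.

End Model.

(** * The periodic solution *)

Theorem corollary2 (R : realType) (N K omega tau : nat)
    (c : 'I_N -> nat -> R)
    (d : 'I_N -> 'I_N -> 'I_K -> nat -> nat)
    (b : 'I_N -> 'I_N -> 'I_K -> nat -> R)
    (I : 'I_N -> nat -> R)
    (f : 'I_N -> 'I_N -> 'I_K -> R -> R)
    (F : 'I_N -> 'I_N -> 'I_K -> R)
    (N_gt0 : (0 < N)%N) (K_gt0 : (0 < K)%N) (omega_gt0 : (0 < omega)%N)
    (c_bounds : forall i m, -1 < c i m < 1)
    (c_periodic : forall i, periodic omega (c i))
    (d_periodic : forall i j k, periodic omega (d i j k))
    (b_periodic : forall i j k, periodic omega (b i j k))
    (I_periodic : forall i, periodic omega (I i))
    (f_lipschitz : forall i j k, lipschitz_with (F i j k) (f i j k))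
    (M_Mmatrix : nonsingular_Mmatrix (model_matrix omega c b F)) :
  let h := max_delay omega tau d in
  let sol := is_solution tau c d b I f in
  exists xs : trajectory R N,
    [/\ sol xs /\ periodic_trajectory h omega xs,
        forall ys, sol ys -> periodic_trajectory h omega ys ->
          eq_trajectory h ys xs &
        globally_exponentially_stable h sol xs].
Proof.
move=> h sol.
have tau_le : (tau <= h)%N by rewrite leq_max leqnn.
have d_le i j k m : (d i j k m <= h)%N by exact: delay_le_max.
have F_ge0 i j k : 0 <= F i j k by exact: lipschitz_with_ge0 (f_lipschitz i j k).
have [v [zeta [zeta_gt0 zeta_lt1 v_ge1 row_le]]] :=
  model_decay_rate h F_ge0 M_Mmatrix.
have [xs [solxs xs_per]] : exists xs, sol xs /\ periodic_trajectory h omega xs.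
  exact: (periodic_solution_exists tau_le d_le omega_gt0 c_periodic d_periodic
    b_periodic I_periodic f_lipschitz zeta_gt0 zeta_lt1 v_ge1 row_le).
exists xs; split=> // [ys solys ys_per|].
- exact: (periodic_solution_unique tau_le d_le omega_gt0 c_periodic b_periodic
    f_lipschitz zeta_gt0 zeta_lt1 v_ge1 row_le solys ys_per solxs xs_per).
- exact: (solution_stable tau_le d_le omega_gt0 c_periodic b_periodic
    f_lipschitz zeta_gt0 zeta_lt1 v_ge1 row_le solxs).
Qed.
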